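(* For every integer $n\ge 1$, the Sierpiński gasket graph $S_n$ is pancyclic, i.e. for every integer $\ell$ with $3\le \ell\le |V(S_n)|$ the graph $S_n$ contains a cycle of length $\ell$.
   Context: The Sierpiński gasket graph $S_n$ ($n\ge1$) is the finite simple graph whose vertices are the intersection points of the line segments in the $n$-th finite stage of the Sierpiński gasket and whose edges are the segments joining consecutive such points. Equivalently, it is defined recursively as follows. $S_1$ is a triangle ($K_3$), with its three vertices designated as the top, left and right corner vertices. For $n\ge1$, $S_{n+1}$ is obtained from three disjoint copies $S_{n+1,T}$ (top), $S_{n+1,L}$ (bottom left), $S_{n+1,R}$ (bottom right) of $S_n$ by identifying the left corner of $S_{n+1,T}$ with the top corner of $S_{n+1,L}$, the right corner of $S_{n+1,T}$ with the top corner of $S_{n+1,R}$, and the right corner of $S_{n+1,L}$ with the left corner of $S_{n+1,R}$. The top, left and right corners of $S_{n+1}$ are the top corner of $S_{n+1,T}$, the left corner of $S_{n+1,L}$ and the right corner of $S_{n+1,R}$, respectively. *)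

(* Defs.v *)
From HB Require Import structures.
From mathcomp Require Import all_boot.

Set Implicit Arguments.
Unset Strict Implicit.
Unset Printing Implicit Defensive.
Set Warnings "-redundant-canonical-projection".

Local Open Scope quotient_scope.

Record sgraph := SGraph {
  vertex : finType;
  adj : rel vertex;
  adj_sym : symmetric adj;
  adj_irrefl : irreflexive adj }.

(* [ucycle] alone also accepts the empty cycle and a pair of adjacent vertices,
   hence the explicit lower bound on the length. *)
Definition has_cycle_of_length (G : sgraph) (l : nat) : Prop :=
  exists c : seq (vertex G), [/\ 3 <= l, size c = l & ucycle (@adj G) c].

Definition pancyclic (G : sgraph) : Prop :=
  forall l : nat, 3 <= l <= #|vertex G| -> has_cycle_of_length G l.

(* The positions top, left, right are encoded as 0, 1, 2 : 'I_3; they index both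
   the corners of a graph and the three copies that are glued together. *)
Record cornered := Cornered {
  graph_of :> sgraph;
  corner : 'I_3 -> vertex graph_of;
  corner_inj : injective corner }.

Lemma K3_sym : symmetric (fun x y : 'I_3 => x != y).
Proof. by move=> x y; rewrite eq_sym. Qed.

Lemma K3_irrefl : irreflexive (fun x y : 'I_3 => x != y).
Proof. by move=> x; rewrite eqxx. Qed.

Definition triangle : cornered :=
  @Cornered (SGraph K3_sym K3_irrefl) id (@inj_id _).

Section Glue.
Variable G : cornered.
Local Notation copies := ('I_3 * vertex G)%type.

(* [(i, u)] is the vertex u of copy i. The three prescribed identifications
   (left of T with top of L, right of T with top of R, right of L with left of R)
   are exactly: corner j of copy i with corner i of copy j, for i <> j. For i = j
   the second clause forces p = q. *)
Definition glue_rel : rel copies := fun p q =>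
  (p == q) || (p.2 == corner G q.1) && (q.2 == corner G p.1).

Lemma glue_rel_refl : reflexive glue_rel.
Proof. by move=> p; rewrite /glue_rel eqxx. Qed.

Lemma glue_rel_sym : symmetric glue_rel.
Proof. by move=> p q; rewrite /glue_rel eq_sym [in RHS]andbC. Qed.

Lemma glue_rel_trans : transitive glue_rel.
Proof.
move=> [j y] [i x] [k z]; rewrite /glue_rel /=.
case/orP=> [/eqP[-> ->] //|/andP[/eqP-> /eqP yi]].
case/orP=> [/eqP[<- <-]|/andP[/eqP yk /eqP->]].
  by rewrite yi !eqxx orbT.
have -> : i = k by apply: (@corner_inj G); rewrite -yi -yk.
by rewrite eqxx.
Qed.

Canonical glue_equiv := EquivRel glue_rel glue_rel_refl glue_rel_sym glue_rel_trans.

Definition glue_vertex := {eq_quot glue_rel}.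
HB.instance Definition _ := EqQuotient.on glue_vertex.
HB.instance Definition _ := Countable.on glue_vertex.
HB.instance Definition _ : isFinite glue_vertex := CanIsFinite (@reprK _ glue_vertex).

Definition in_copy (i : 'I_3) (u : vertex G) : glue_vertex := \pi_glue_vertex (i, u).

Lemma in_copy_eq i u j v : (in_copy i u == in_copy j v) = glue_rel (i, u) (j, v).
Proof. by rewrite /in_copy piE. Qed.

Lemma in_copy_inj i : injective (in_copy i).
Proof.
move=> u v /eqP; rewrite in_copy_eq => /orP[/eqP[]//|/andP[/eqP/= -> /eqP->]//].
Qed.

Definition glue_adj : rel glue_vertex := fun x y =>
  [exists i, exists u, exists v,
     [&& x == in_copy i u, y == in_copy i v & adj u v]].

Lemma glue_adj_sym : symmetric glue_adj.
Proof.
suff H x y : glue_adj x y -> glue_adj y x by move=> x y; apply/idP/idP; apply: H.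
case/existsP=> i /existsP[u /existsP[v /and3P[xu yv uv]]].
apply/existsP; exists i; apply/existsP; exists v; apply/existsP; exists u.
by rewrite xu yv adj_sym.
Qed.

Lemma glue_adj_irrefl : irreflexive glue_adj.
Proof.
move=> x; apply: contraFF (erefl false).
case/existsP=> i /existsP[u /existsP[v /and3P[/eqP-> /eqP e]]].
by rewrite (in_copy_inj e) adj_irrefl.
Qed.

Definition glue_graph : sgraph := SGraph glue_adj_sym glue_adj_irrefl.

Definition glue_corner (i : 'I_3) : vertex glue_graph := in_copy i (corner G i).

Lemma glue_corner_inj : injective glue_corner.
Proof.
move=> i j /eqP; rewrite in_copy_eq => /orP[/eqP[]//|/andP[/eqP/= /corner_inj //]].
Qed.

Definition glue : cornered := Cornered glue_corner_inj.

End Glue.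

(* [sierpinski n] is S_n for n >= 1; [sierpinski 0] is a junk value (K_3). *)
Definition sierpinski (n : nat) : cornered := iter n.-1 glue triangle.

(* Main.v *)
Require Import Defs.
From mathcomp Require Import all_boot.
From mathcomp Require Import zify.

Set Implicit Arguments.
Unset Strict Implicit.
Unset Printing Implicit Defensive.

(** Write N for the number of vertices of S_n and d = 2^(n-1) for the distance
    between two of its corners. By induction on n, any two corners are joined by
    paths with every number of edges from d to N - 1, and by paths avoiding the
    third corner with every number of edges from d to N - 2. A path between two
    corners of S_(n+1) runs through two copies of S_n, or through all three: in
    the latter case the first and the last copy share a vertex, which one of the
    two pieces has to avoid. Going once around the three copies gives the cycles
    of lengths 3d to 3N - 3 = |V(S_(n+1))|, and the shorter ones already live in
    a single copy because 3d <= N + 1. *)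

(** * Splitting lengths, and simple paths in a graph *)

(** This distributes a prescribed length over the pieces of a path; two uses handle three pieces.
    The first summand is taken as large as possible. *)
Lemma split_sum {l1 h1 l2 h2 a : nat} :
  l1 <= h1 -> l2 <= h2 -> l1 + l2 <= a <= h1 + h2 ->
  exists b c, [/\ l1 <= b <= h1, l2 <= c <= h2 & a = b + c].
Proof.
move=> le1 le2 a_bd.
by exists (minn h1 (a - l2)), (a - minn h1 (a - l2)); split; lia.
Qed.

Lemma uniq3 (i j k : 'I_3) :
  uniq [:: i; j; k] -> [/\ i != j, i != k & j != k].
Proof. by rewrite /= !inE negb_or andbT => /andP[/andP[-> ->] ->]. Qed.

(* The starting point [x] is not listed in [p], so that [size p] counts the edges. *)
Definition simple_path {G : sgraph} (x y : vertex G) (p : seq (vertex G)) : Prop :=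
  [/\ path (@adj G) x p, last x p = y & uniq (x :: p)].

Lemma simple_path_cat {G : sgraph} (x y z : vertex G) p q :
  simple_path x y p -> simple_path y z q -> ~~ has (mem (x :: p)) q ->
  simple_path x z (p ++ q).
Proof.
move=> [xp py up] [yq qz uq] dis; split.
- by rewrite cat_path xp py.
- by rewrite last_cat py.
- by move: uq; rewrite -cat_cons cat_uniq up dis cons_uniq => /andP[].
Qed.

Lemma simple_path_cycle {G : sgraph} (x y : vertex G) p q :
  simple_path x y p -> simple_path y x q -> ~~ has (mem p) q ->
  3 <= size p + size q -> has_cycle_of_length G (size p + size q).
Proof.
move=> [xp py up] [yq qx uq] dis sz.
(* Each endpoint is listed once: [y] closes [p] and [x] closes [q]. *)
exists (p ++ q); split=> //; first by rewrite size_cat.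
apply/andP; split.
  by rewrite (cycle_path x) last_cat py qx cat_path xp py.
by move: up uq; rewrite cat_uniq dis !cons_uniq => /andP[_ ->] /andP[_ ->].
Qed.

Lemma simple_path_notin {G : sgraph} (x y : vertex G) p :
  simple_path x y p -> x \notin p.
Proof. by case=> _ _ /andP[]. Qed.

(** * Paths and cycles in the glued graph *)

Section GluedPaths.
Variable G : cornered.
Implicit Types (i j k : 'I_3) (s p q r : seq (vertex G)).

Local Notation inG i := (@in_copy G i : vertex G -> vertex (glue G)).
Local Notation lift i := (map (inG i)).

Lemma in_copy_cornerC i j : inG i (corner G j) = inG j (corner G i).
Proof. by apply/eqP; rewrite in_copy_eq /glue_rel /= !eqxx orbT. Qed.

Lemma in_copy_meet i j u v :
  i != j -> inG i u = inG j v -> u = corner G j /\ v = corner G i.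
Proof.
move=> ij /eqP; rewrite in_copy_eq => /orP[/eqP[/eqP]|/andP[/= /eqP-> /eqP->] //].
by rewrite (negPf ij).
Qed.

(** Two copies share a single vertex, so it is enough that one of the two lists misses it. *)
Lemma lift_disjoint i j s q :
  i != j -> (corner G j \notin s) || (corner G i \notin q) ->
  ~~ has (mem (lift i s)) (lift j q).
Proof.
move=> ij; apply: contraTN => /hasP[_ /mapP[v vq ->] /mapP[u us]].
rewrite eq_sym in ij => /(in_copy_meet ij) [vi uj].
by rewrite -vi -uj vq us.
Qed.

Lemma glue_corner_notin i k s :
  i != k -> corner (glue G) k \notin lift i s.
Proof.
move=> ik; apply/mapP=> -[u _]; rewrite eq_sym in ik.
by case/(in_copy_meet ik)=> /corner_inj e; rewrite e eqxx in ik.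
Qed.

Lemma glue_corner_in i s : (corner (glue G) i \in lift i s) = (corner G i \in s).
Proof. exact: (mem_map (@in_copy_inj G i)). Qed.

Lemma in_copy_adj i : {homo inG i : u v / adj u v >-> adj u v}.
Proof.
move=> u v uv; apply/existsP; exists i; apply/existsP; exists u.
by apply/existsP; exists v; rewrite !eqxx.
Qed.

Lemma lift_simple_path i u v p :
  simple_path u v p -> simple_path (inG i u) (inG i v) (lift i p).
Proof.
move=> [up pv uniqp]; split.
- exact: homo_path (in_copy_adj i) up.
- by rewrite last_map pv.
- by rewrite -map_cons map_inj_uniq //; apply: in_copy_inj.
Qed.

Lemma lift_cycle l : has_cycle_of_length G l -> has_cycle_of_length (glue G) l.
Proof.
case=> c [l3 sc /andP[cc uc]]; exists (lift ord0 c); split=> //.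
  by rewrite size_map.
apply/andP; split; last by rewrite map_inj_uniq //; apply: in_copy_inj.
exact: homo_cycle (in_copy_adj ord0) _ cc.
Qed.

Lemma two_copies_path i j p q :
  i != j ->
  simple_path (corner G i) (corner G j) p ->
  simple_path (corner G i) (corner G j) q ->
  simple_path (corner (glue G) i) (corner (glue G) j) (lift i p ++ lift j q).
Proof.
move=> ij Pp Pq; apply: (@simple_path_cat _ _ (inG i (corner G j))).
- exact: lift_simple_path.
- by rewrite in_copy_cornerC; apply: lift_simple_path.
- rewrite -[_ :: _]/(lift i (corner G i :: p)).
  by apply: lift_disjoint; rewrite // (simple_path_notin Pq) orbT.
Qed.

(** The route visits the copies [i], [k], [j]. Since [p] may pass through the vertex shared by
    copies [i] and [j], it is [r] that must avoid it; in copy [j] it is [corner G i]. *)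
Lemma three_copies_path i j k p q r :
  uniq [:: i; j; k] ->
  simple_path (corner G i) (corner G k) p ->
  simple_path (corner G i) (corner G j) q ->
  simple_path (corner G k) (corner G j) r -> corner G i \notin r ->
  simple_path (corner (glue G) i) (corner (glue G) j)
    (lift i p ++ lift k q ++ lift j r).
Proof.
case/uniq3=> ij ik jk Pp Pq Pr ir; have kj : k != j by rewrite eq_sym.
rewrite catA; apply: (@simple_path_cat _ _ (inG j (corner G k))).
- apply: (@simple_path_cat _ _ (inG k (corner G i))).
  + by rewrite in_copy_cornerC; apply: lift_simple_path.
  + by rewrite (in_copy_cornerC j); apply: lift_simple_path.
  + rewrite -[_ :: _]/(lift i (corner G i :: p)).
    by apply: lift_disjoint; rewrite // (simple_path_notin Pq) orbT.
- exact: lift_simple_path.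
- rewrite -cat_cons -[_ :: lift i p]/(lift i (corner G i :: p)).
  rewrite has_sym has_cat negb_or.
  apply/andP; split; rewrite has_sym; apply: lift_disjoint => //.
    by rewrite ir orbT.
  by rewrite (simple_path_notin Pr) orbT.
Qed.

(** No avoidance is assumed: each junction ends one piece and starts the next, and starting points
    are not listed, so it occurs once. *)
Lemma three_copies_cycle i j k p q r :
  uniq [:: i; j; k] ->
  simple_path (corner G k) (corner G j) p ->
  simple_path (corner G i) (corner G k) q ->
  simple_path (corner G j) (corner G i) r ->
  3 <= size p + size q + size r ->
  has_cycle_of_length (glue G) (size p + size q + size r).
Proof.
case/uniq3=> ij ik jk Pp Pq Pr.
have -> : size p + size q + size r =
    size (lift i p ++ lift j q) + size (lift k r) by rewrite size_cat !size_map.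
have kp := simple_path_notin Pp; have iq := simple_path_notin Pq.
have jr := simple_path_notin Pr.
apply: (@simple_path_cycle _ (inG i (corner G k)) (inG j (corner G k))).
- apply: (@simple_path_cat _ _ (inG i (corner G j))).
  + exact: lift_simple_path.
  + by rewrite in_copy_cornerC; apply: lift_simple_path.
  + rewrite -[_ :: _]/(lift i (corner G k :: p)).
    by apply: lift_disjoint; rewrite // iq orbT.
- by rewrite !(in_copy_cornerC _ k); apply: lift_simple_path.
- rewrite has_sym has_cat negb_or.
  apply/andP; split; rewrite has_sym; apply: lift_disjoint => //.
    by rewrite kp.
  by rewrite jr orbT.
Qed.

(* Discarding one of the two representatives of each junction ([dup] in the
   proof) leaves a set that still covers all vertices. *)
Lemma card_glue : #|vertex (glue G)| <= 3 * #|vertex G| - 3.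
Proof.
pose o1 : 'I_3 := inord 1; pose o2 : 'I_3 := inord 2.
have o01 : ord0 != o1 by rewrite -val_eqE /= inordK.
have o12 : o1 != o2 by rewrite -val_eqE /= !inordK.
pose dup := [:: (ord0 : 'I_3, corner G o1); (ord0, corner G o2); (o1, corner G o2)].
have udup : uniq dup.
  rewrite /= !inE !xpair_eqE !(inj_eq (@corner_inj G)).
  by rewrite (negPf o01) (negPf o12) !andbF.
pose A := [set p | p \notin dup].
have -> : 3 * #|vertex G| - 3 = #|A|.
  have := cardC (mem dup); rewrite (card_uniqP udup) card_prod card_ord => <-.
  by rewrite addKn cardsE; apply: eq_card => p; rewrite !inE.
pose f (p : 'I_3 * vertex G) := inG p.1 p.2.
apply: leq_trans (leq_imset_card f A); rewrite -cardsT; apply/subset_leq_card.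
apply/subsetP => x _; rewrite -[x]reprK; case: (repr x) => i u.
apply/imsetP; case: (boolP ((i, u) \in dup)) => [|ndup]; last first.
  by exists (i, u); rewrite ?in_set.
(* [dup] holds the representatives whose copy index is below the corner index; swapping the two
   indices names the same vertex outside [dup]. *)
have swap j : u = corner G j -> (j, corner G i) \notin dup ->
    exists2 p, p \in A & inG i u = f p.
  by move=> -> nd; exists (j, corner G i); rewrite ?in_set // /f in_copy_cornerC.
rewrite !inE => /or3P[] /eqP[ei eu]; apply: (swap _ eu);
  by rewrite ei !inE !xpair_eqE !(inj_eq (@corner_inj G)) -!val_eqE /= !inordK.
Qed.

End GluedPaths.

(** * The induction on the stage *)

(* [d] and [N] stand for the corner distance and the number of vertices; that
   [N] is at least the latter is all that is needed. *)
Record rich_paths (G : cornered) (d N : nat) : Prop := RichPaths {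
  rich_bounds : [/\ 0 < d, 3 <= N & 3 * d <= N + 1];
  rich_card : #|vertex G| <= N;
  rich_pancyclic : forall l, 3 <= l <= N -> has_cycle_of_length G l;
  rich_path : forall i j a, i != j -> d <= a <= N.-1 ->
    exists2 p, simple_path (corner G i) (corner G j) p & size p = a;
  rich_avoiding_path : forall i j k a, uniq [:: i; j; k] -> d <= a <= N.-2 ->
    exists p, [/\ simple_path (corner G i) (corner G j) p,
                  corner G k \notin p & size p = a] }.

Lemma third_index (i j : 'I_3) : i != j -> exists k, uniq [:: i; j; k].
Proof.
move=> ij; have : 0 < #|[predC [:: i; j]]|.
  rewrite -(ltn_add2l #|[:: i; j]|) cardC card_ord addn0.
  by apply: leq_ltn_trans (card_size _) _.
case/card_gt0P=> k; rewrite !inE negb_or => /andP[ki kj]; exists k.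
by rewrite /= !inE negb_or ij eq_sym ki eq_sym kj.
Qed.

Lemma rich_triangle : rich_paths triangle 1 3.
Proof.
have path1 (i j : 'I_3) : i != j -> @simple_path triangle i j [:: j].
  by move=> ij; split; rewrite //= ?inE ?ij.
split=> //.
- by rewrite card_ord.
- move=> l l3; have -> : l = 3 by lia.
  exists [:: ord0; inord 1; inord 2]; split=> //.
  by rewrite /ucycle /= !inE -!val_eqE /= !inordK.
- move=> i j a ij; case: a => [|[|[|a]]] // _.
    by exists [:: j]; [exact: path1|].
  have [k /uniq3[_ ik jk]] := third_index ij.
  exists [:: k; j] => //.
  by split; rewrite //= ?inE ?negb_or ?ik ?ij (eq_sym k) ?jk.
- move=> i j k a /uniq3[ij ik jk]; case: a => [|[|a]] // _.
  by exists [:: j]; split; [exact: path1|rewrite inE eq_sym|].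
Qed.

Lemma rich_glue (G : cornered) (d N : nat) :
  rich_paths G d N -> rich_paths (glue G) (2 * d) (3 * N - 3).
Proof.
case=> -[d0 N3 dN] cardG cyc pth avo.
have le1 : d <= N.-1 by lia.
have le2 : d <= N.-2 by lia.
split.
(* Doubling [3 * d <= N + 1] suffices once [4 <= N]; for [N = 3] it forces [d = 1]. *)
- split; lia.
- by apply: leq_trans (card_glue G) _; rewrite leq_sub2r // leq_mul2l cardG.
- move=> l l_bd; case: (leqP l N) => [lN|Nl]; first by apply/lift_cycle/cyc; lia.
  have [|b' [a3 [b'_bd a3_bd e]]] := split_sum (a := l) (leq_add le1 le1) le1.
    by lia.
  have [a1 [a2 [a1_bd a2_bd e']]] := split_sum le1 le1 b'_bd.
  have [|k uk] := @third_index ord0 (inord 1); first by rewrite -val_eqE /= inordK.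
  have [ij ik jk] := uniq3 uk.
  have kj : k != inord 1 by rewrite eq_sym.
  have ji : inord 1 != ord0 :> 'I_3 by rewrite eq_sym.
  have [p Pp sp] := pth _ _ _ kj a1_bd.
  have [q Pq sq] := pth _ _ _ ik a2_bd.
  have [r Pr sr] := pth _ _ _ ji a3_bd.
  have -> : l = size p + size q + size r by lia.
  by apply: (three_copies_cycle uk) => //; lia.
- move=> i j a ij a_bd; case: (leqP a (N.-1 + N.-1)) => [aN|Na].
    have [|a1 [a2 [a1_bd a2_bd e]]] := split_sum (a := a) le1 le1; first by lia.
    have [p Pp sp] := pth _ _ _ ij a1_bd.
    have [q Pq sq] := pth _ _ _ ij a2_bd.
    exists (map (@in_copy G i) p ++ map (@in_copy G j) q).
      exact: two_copies_path.
    by rewrite size_cat !size_map; lia.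
  have [k uk] := third_index ij; have [_ ik jk] := uniq3 uk.
  have ukji : uniq [:: k; j; i] by rewrite -rev_uniq.
  (* Three pieces, the last one avoiding a corner, reach 2(N - 1) + (N - 2) = 3N - 4 edges. No
     length is skipped, as 3d <= N + 1 <= 2N - 1. *)
  have [|b' [a3 [b'_bd a3_bd e]]] := split_sum (a := a) (leq_add le1 le1) le2.
    by lia.
  have [a1 [a2 [a1_bd a2_bd e']]] := split_sum le1 le1 b'_bd.
  have [p Pp sp] := pth _ _ _ ik a1_bd.
  have [q Pq sq] := pth _ _ _ ij a2_bd.
  have [r [Pr ir sr]] := avo _ _ _ _ ukji a3_bd.
  exists (map (@in_copy G i) p ++ map (@in_copy G k) q ++ map (@in_copy G j) r).
    exact: three_copies_path.
  by rewrite !size_cat !size_map; lia.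
- move=> i j k a uk a_bd; have [ij ik jk] := uniq3 uk.
  case: (leqP a (N.-1 + N.-1)) => [aN|Na].
    have [|a1 [a2 [a1_bd a2_bd e]]] := split_sum (a := a) le1 le1; first by lia.
    have [p Pp sp] := pth _ _ _ ij a1_bd.
    have [q Pq sq] := pth _ _ _ ij a2_bd.
    exists (map (@in_copy G i) p ++ map (@in_copy G j) q); split.
    + exact: two_copies_path.
    (* The outer corner [k] lies in copy [k] only, which this path does not use. *)
    + by rewrite mem_cat negb_or !glue_corner_notin.
    + by rewrite size_cat !size_map; lia.
  have ukji : uniq [:: k; j; i] by rewrite -rev_uniq.
  (* The middle piece runs in copy [k] and must avoid its outer corner, which costs one more edge:
     the maximum is 3N - 5. *)
  have [|b' [a3 [b'_bd a3_bd e]]] := split_sum (a := a) (leq_add le1 le2) le2.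
    by lia.
  have [a1 [a2 [a1_bd a2_bd e']]] := split_sum le1 le2 b'_bd.
  have [p Pp sp] := pth _ _ _ ik a1_bd.
  have [q [Pq kq sq]] := avo _ _ _ _ uk a2_bd.
  have [r [Pr ir sr]] := avo _ _ _ _ ukji a3_bd.
  exists (map (@in_copy G i) p ++ map (@in_copy G k) q ++ map (@in_copy G j) r).
  split.
  + exact: three_copies_path.
  + by rewrite !mem_cat !negb_or glue_corner_in kq !glue_corner_notin.
  + by rewrite !size_cat !size_map; lia.
Qed.

Theorem theorem6 (n : nat) (hn : 1 <= n) : pancyclic (sierpinski n).
Proof.
have [d [N [_ cardS cyc _ _]]] : exists d N, rich_paths (sierpinski n) d N.
  rewrite /sierpinski; elim: n.-1 => [|m [d [N IH]]].
    by exists 1, 3; apply: rich_triangle.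
  by exists (2 * d), (3 * N - 3); apply: rich_glue.
move=> l /andP[l3 lS]; apply: cyc.
by rewrite l3 (leq_trans lS cardS).
Qed.
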